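(* There is a sufficiently large constant $C$ such that the following holds. Suppose $p=p(n)$ satisfies $d=p(n-1)\ge \log^3 n$ and $k=k(n)$ satisfies $C\sqrt{n\log n}\le k<n$. Let $r=r(d,k)$ be the smallest positive integer such that $d^{r+1}\ge Cn\log n/k$, and let $G\in\mathcal{G}(n,p)$. Then asymptotically almost surely $\mathrm{capt}_k(G)=\Theta(r)$.
   Context: $\mathcal{G}(n,p)$ is the binomial random graph on vertex set $[n]$ in which each pair of vertices is an edge independently with probability $p$ (viewed as a reflexive graph). An event holds asymptotically almost surely (a.a.s.) if its probability tends to 1 as $n\to\infty$. The game of Cops and Robbers: cops choose starting vertices (round 0), then the robber; players alternate, cops (any subset) moving to adjacent vertices or staying put, then the robber moving or staying; cops win by occupying the robber's vertex. For $k$ at least the cop number, $\mathrm{capt}_k(G)$ is the minimum over $k$-cop strategies of the number of rounds (excluding round 0) until capture against an optimally evading robber. $\log$ is the natural logarithm. *)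

(* Defs.v *)
From HB Require Import structures.
From mathcomp Require Import all_boot all_order all_algebra.
From mathcomp Require Import all_classical all_reals all_analysis.
Set Implicit Arguments.
Unset Strict Implicit.
Unset Printing Implicit Defensive.
Import Order.TTheory GRing.Theory Num.Theory.
Import numFieldNormedType.Exports.
Local Open Scope classical_set_scope.
Local Open Scope ring_scope.

(* Cops and Robbers with k cops on a finite graph with vertex type V. The
   relation e is the adjacency of the graph viewed as reflexive: e x x holds,
   so staying put is a move along a loop. *)

(* A cop strategy maps the robber's past positions to the cops' positions:
   s [::] is the placement in round 0, and s [:: x_0; ...; x_(t-1)] is the
   position after the cops' move in round t, the robber having stood on x_i at
   the end of round i. The cops' own past positions are determined by s. *)
Definition cop_strategy (V : finType) (k : nat) := seq V -> {ffun 'I_k -> V}.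

Definition legal_strategy (V : finType) (e : rel V) (k : nat)
    (s : cop_strategy V k) : Prop :=
  forall (h : seq V) (x : V) (i : 'I_k), e (s h i) (s (rcons h x) i).

(* w t is the position of the robber at the end of round t. Against a fixed
   strategy of the cops, the robber's plays are exactly the walks. *)
Definition robber_walk (V : finType) (e : rel V) (w : nat -> V) : Prop :=
  forall t : nat, e (w t) (w t.+1).

(* Some cop stands on the robber's vertex in round t, either just after the
   cops' move (the robber is still on w t.-1) or after the robber's move. For
   t = 0 the two cases coincide. *)
Definition capture (V : finType) (k : nat) (s : cop_strategy V k)
    (w : nat -> V) (t : nat) : Prop :=
  exists i : 'I_k, s (mkseq w t) i = w t.-1 \/ s (mkseq w t) i = w t.

(* Numbers of rounds are extended reals; +oo means that there is no capture. *)
Definition rounds (R : realType) (V : finType) (k : nat) (s : cop_strategy V k)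
    (w : nat -> V) : \bar R :=
  ereal_inf [set t%:R%:E | t in capture s w].

Definition strategy_rounds (R : realType) (V : finType) (e : rel V) (k : nat)
    (s : cop_strategy V k) : \bar R :=
  ereal_sup [set rounds R s w | w in robber_walk e].

(* The infimum is over a set of values in nat together with +oo, hence it is a
   minimum; it is +oo when k is smaller than the cop number. *)
Definition capt (R : realType) (V : finType) (e : rel V) (k : nat) : \bar R :=
  ereal_inf [set strategy_rounds R e s | s in legal_strategy e (k := k)].

Definition pairs (n : nat) : {set {set 'I_n}} := [set a : {set 'I_n} | #|a| == 2].

Definition radj (n : nat) (E : {set {set 'I_n}}) : rel 'I_n :=
  fun x y => (x == y) || ([set x; y]%SET \in E).

(* The probability that the graph G(n,p), given by its edge set, satisfies A. *)
Definition gnp_prob (R : realType) (n : nat) (p : R)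
    (A : {set {set 'I_n}} -> Prop) : R :=
  \sum_(E : {set {set 'I_n}} | (E \subset pairs n) && `[< A E >])
    \prod_(a in pairs n) (if a \in E then p else 1 - p).

Definition is_least_radius (R : realType) (C : R) (n : nat) (d : R)
    (k r : nat) : Prop :=
  let good j := C * n%:R * ln n%:R / k%:R <= d ^+ j.+1 in
  [/\ (0 < r)%N, good r & forall j : nat, (0 < j)%N -> good j -> (r <= j)%N].

(* Main.v *)
Require Import Defs.
From HB Require Import structures.
From mathcomp Require Import all_boot all_order all_algebra.
From mathcomp Require Import all_classical all_reals all_analysis.
From mathcomp Require Import ring lra.
Import Order.TTheory GRing.Theory Num.Theory.
Import numFieldNormedType.Exports.
Local Open Scope classical_set_scope.
Local Open Scope ring_scope.

(* Write L = log n. Almost surely every closed neighborhood has size at most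
   (1 + O(1/L)) d, and every nonempty set S satisfies
   1 / |N[S]| <= (1 + O(1/L)) / (d |S|) + O(1/n); since d >= L^3, a deviation of
   order 1/L is within reach of a Chernoff bound and a union bound over all S.
   The recursion in 1 / |N[S]| is linear, and in a range of O(L) steps the losses
   multiply to a constant, so balls of radius rho have size O(d^rho) and
   |N^(rho+1)[S]| >= c min(|S| d^(rho+1), n).
   Upper bound: some placement of the cops puts a positive proportion of the
   expected number of cops into every N^(rho+1)[S] with |S| = O(1 + n / d^(rho+1)).
   By Hall's theorem, once the robber has started at v, the ball of radius rho
   around v can be matched to cops at distance at most rho + 1, who occupy this
   whole ball before the robber leaves it. One takes rho = r, or rho = 0 if
   d > k / C, which forces r = 1.
   Lower bound: the balls of radius r - 1 around the k cops do not cover the graph. *)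

(** * Hall's theorem and iterated neighborhoods *)

Section Combinatorics.
Set Implicit Arguments.
Unset Strict Implicit.
Unset Printing Implicit Defensive.
Local Open Scope nat_scope.
Local Open Scope set_scope.

Lemma subset_of_card (T : finType) (A : {set T}) (m : nat) :
  m <= #|A| -> exists2 B : {set T}, B \subset A & #|B| = m.
Proof.
move=> /card_geqP[s [Us <- sA]]; exists [set x in s].
  by apply/fintype.subsetP => x; rewrite inE => /sA.
by rewrite cardsE; apply/card_uniqP.
Qed.

(** Induction on the size of [B]. If a proper nonempty part [A] is tight, [A] is matched into its
    neighbors and the rest of [B] outside them; if no such part is tight, any choice for one element
    keeps the condition for the others. The value [j0] covers empty [B]. *)
Lemma hall_marriage (I J : finType) (N : I -> {set J}) (B : {set I}) (j0 : J) :
  (forall A : {set I}, A \subset B -> #|A| <= #|\bigcup_(a in A) N a|) ->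
  exists2 g : I -> J, {in B, forall a, g a \in N a} & {in B &, injective g}.
Proof.
have [m] := ubnP #|B|; elim: m => // m IH in N B *.
rewrite ltnS => leBm hallB.
have [->|[b bB]] := set_0Vmem B.
  by exists (fun=> j0) => [a|a1 a2]; rewrite inE.
have [/existsP[A /and4P[sAB A0 AB leA]]|/existsPn noncrit] := boolP [exists A : {set I},
    [&& A \subset B, A != finset.set0, A != B & #|\bigcup_(a in A) N a| <= #|A|]].
  set NA := \bigcup_(a in A) N a in leA.
  have ltAB : #|A| < #|B|.
    by apply: proper_card; rewrite finset.properEneq AB.
  have [g1 g1N g1I] : exists2 g : I -> J, {in A, forall a, g a \in N a} & {in A &, injective g}.
    apply: IH; first exact: leq_trans ltAB leBm.
    by move=> A' sA'; apply: hallB; apply: fintype.subset_trans sAB.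
  have [g2 g2N g2I] : exists2 g : I -> J, {in B :\: A, forall a, g a \in N a :\: NA}
      & {in B :\: A &, injective g}.
    apply: IH.
      rewrite cardsDS //; apply: leq_trans leBm.
      by rewrite ltn_subrL (leq_ltn_trans _ ltAB) // andbT card_gt0.
    move=> A' sA'.
    have dis : A :&: A' = finset.set0.
      apply/eqP; rewrite finset.setI_eq0 disjoint_sym.
      by apply: disjointWl sA' _; rewrite -finset.setI_eq0 finset.setIDAC finset.setDIl finset.setDv finset.setI0.
    (* Hall's condition for [A :|: A'], less the at most [#|A|] neighbors in [NA], is the condition
       for [A'] outside [NA]. *)
    have := hallB (A :|: A').
    rewrite finset.subUset sAB (fintype.subset_trans sA' (finset.subsetDl _ _)) => /(_ isT).
    rewrite cardsU dis cards0 subn0 => h.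
    have h2 : #|\bigcup_(a in A :|: A') N a| <= #|NA| + #|\bigcup_(a in A') (N a :\: NA)|.
      apply: leq_trans (leq_subr #|NA :&: \bigcup_(a in A') (N a :\: NA)| _).
      rewrite -cardsU; apply: subset_leq_card.
      apply/bigcupsP => a; rewrite inE => /orP[aA|aA'].
        by apply: fintype.subset_trans (finset.subsetUl _ _); exact: finset.bigcup_sup.
      apply/fintype.subsetP => j ja; rewrite inE; case: (boolP (j \in NA)) => //= jNA.
      by apply/bigcupP; exists a => //; rewrite inE jNA.
    by rewrite -(leq_add2l #|A|) (leq_trans h) // (leq_trans h2) // leq_add2r.
  exists (fun a => if a \in A then g1 a else g2 a).
    move=> a aB; case: ifPn => aA; first exact: g1N.
    by have := g2N a; rewrite !inE aA aB => /(_ isT) /andP[].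
  have cross x y : x \in A -> y \in B -> y \notin A -> g1 x = g2 y -> False.
    move=> xA yB yA e; have := g2N y; rewrite !inE yA yB => /(_ isT) /andP[+ _].
    by rewrite -e => /negP; apply; apply/bigcupP; exists x => //; apply: g1N.
  move=> x y xB yB; case: ifPn => xA; case: ifPn => yA.
  - exact: g1I.
  - by move/cross => /(_ xA yB yA).
  - by move/esym/cross => /(_ yA xB xA).
  - by apply: g2I; rewrite inE ?xA ?yA.
have [j jb] : exists j, j \in N b.
  apply/set0Pn; rewrite -card_gt0.
  by have := hallB [set b]%SET; rewrite finset.sub1set bB cards1 big_set1 => /(_ isT).
have [g gN gI] : exists2 g : I -> J, {in B :\ b, forall a, g a \in N a :\ j}
    & {in B :\ b &, injective g}.
  apply: IH; first by rewrite (cardsD1 b) bB in leBm.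
  move=> A sA; have [->|A0] := eqVneq A finset.set0; first by rewrite cards0.
  have sAB : A \subset B := fintype.subset_trans sA (finset.subsetDl _ _).
  have bA : b \notin A by apply/negP => /(fintype.subsetP sA); rewrite !inE eqxx.
  have := noncrit A; rewrite sAB A0 /= negb_and -ltnNge => /orP[/negPn/eqP AB|lt].
    by rewrite AB bB in bA.
  have -> : \bigcup_(a in A) (N a :\ j) = (\bigcup_(a in A) N a) :\ j.
    apply/finset.setP => i; rewrite !inE; apply/bigcupP/andP.
      by move=> [a aA]; rewrite !inE => /andP[ij ia]; split => //; apply/bigcupP; exists a.
    by move=> [ij /bigcupP[a aA ia]]; exists a => //; rewrite !inE ij.
  rewrite (cardsD1 j) in lt.
  by move: lt; case: (j \in _); rewrite ?add1n ?add0n // => /ltnW.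
exists (fun a => if a == b then j else g a).
  move=> a aB; case: eqP => [->//|/eqP ab].
  by have := gN a; rewrite !inE ab aB => /(_ isT) /andP[].
have cross y : y \in B -> y != b -> j = g y -> False.
  by move=> yB yb e; have := gN y; rewrite !inE yb yB -e eqxx => /(_ isT).
move=> x y xB yB; case: eqP => [->|/eqP xb]; case: eqP => [-> //|/eqP yb].
- by move/cross => /(_ yB yb).
- by move/esym/cross => /(_ xB xb).
- by apply: gI; rewrite !inE ?xb ?yb.
Qed.

(* The closed neighborhood of [A] when [e] is reflexive. *)
Definition nbhd (V : finType) (e : rel V) (A : {set V}) : {set V} :=
  [set y | [exists x in A, e x y]].

Lemma mem_nbhd (V : finType) (e : rel V) (A : {set V}) x y :
  x \in A -> e x y -> y \in nbhd e A.
Proof. by move=> xA exy; rewrite inE; apply/existsP; exists x; rewrite xA. Qed.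

Lemma nbhdS (V : finType) (e : rel V) (A B : {set V}) :
  A \subset B -> nbhd e A \subset nbhd e B.
Proof.
move=> /fintype.subsetP sAB; apply/fintype.subsetP => y; rewrite inE.
by move=> /existsP[x /andP[/sAB xB exy]]; apply: mem_nbhd exy.
Qed.

Lemma iter_nbhdS (V : finType) (e : rel V) (A B : {set V}) j :
  A \subset B -> iter j (nbhd e) A \subset iter j (nbhd e) B.
Proof. by move=> sAB; elim: j => //= j IH; apply: nbhdS. Qed.

Lemma sub_iter_nbhd (V : finType) (e : rel V) (A : {set V}) i j :
  reflexive e -> i <= j -> iter i (nbhd e) A \subset iter j (nbhd e) A.
Proof.
move=> e_refl /subnK <-; elim: (j - i) => [//|m IH]; apply: fintype.subset_trans IH _.
by rewrite addSn /=; apply/fintype.subsetP => x xA; apply: mem_nbhd (e_refl x).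
Qed.

Lemma card_nbhd_le (R : realType) (V : finType) (e : rel V) (D : R) (A : {set V}) :
  (forall x, (#|nbhd e [set x]|%:R <= D)%R) -> (#|nbhd e A|%:R <= D * #|A|%:R)%R.
Proof.
move=> degD; have -> : nbhd e A = \bigcup_(x in A) nbhd e [set x].
  apply/finset.setP => y; rewrite inE; apply/existsP/bigcupP.
    by move=> [x /andP[xA exy]]; exists x => //; rewrite (mem_nbhd _ exy) ?inE.
  move=> [x xA]; rewrite inE => /existsP[x' /andP[]]; rewrite inE => /eqP -> exy.
  by exists x; rewrite xA.
have : (#|\bigcup_(x in A) nbhd e [set x]| <= \sum_(x in A) #|nbhd e [set x]|)%N.
  elim/big_ind2: _ => [|m1 B1 m2 B2 h1 h2|//]; first by rewrite cards0.
  by rewrite cardsU (leq_trans (leq_subr _ _)) // leq_add.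
rewrite -(ler_nat R) => /le_trans; apply.
rewrite natr_sum mulr_natr -sumr_const; exact: ler_sum.
Qed.

Lemma card_iter_nbhd_le (R : realType) (V : finType) (e : rel V) (D : R)
    (A : {set V}) j :
  (forall x, (#|nbhd e [set x]|%:R <= D)%R) ->
  (#|iter j (nbhd e) A|%:R <= D ^+ j * #|A|%:R)%R.
Proof.
move=> degD; elim: j => [|j IH]; first by rewrite expr0 mul1r.
(* The sign of [D] is known only once there is a vertex, so the empty set is treated apart. *)
have [->|[x xA]] := set_0Vmem A.
  rewrite cards0 mulr0 (_ : iter _ _ _ = finset.set0) ?cards0 //.
  elim: (j.+1) => //= i ->; apply/finset.setP => y; rewrite !inE.
  by apply/negbTE/existsPn => x; rewrite inE.
have D0 : (0 <= D)%R by apply: le_trans (degD x).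
rewrite /= (le_trans (card_nbhd_le _ degD)) // exprS -mulrA.
by rewrite ler_wpM2l.
Qed.

(* Padding with stationary steps turns a path of length at most [j] into a walk. *)
Lemma walk_of_iter_nbhd (V : finType) (e : rel V) (A : {set V}) j y :
  reflexive e -> symmetric e -> y \in iter j (nbhd e) A ->
  exists2 x, x \in A & exists pi : nat -> V,
    [/\ pi 0 = y, pi j = x & forall t, e (pi t) (pi t.+1)].
Proof.
move=> e_refl e_sym; elim: j y => [|j IH] y /=.
  by move=> yA; exists y => //; exists (fun=> y); split.
rewrite inE => /existsP[z /andP[/IH[x xA [pi [pi0 pij pie]]] ezy]].
exists x => //; exists (fun t => if t is t'.+1 then pi t' else y); split => //.
by case=> [|t]; [rewrite pi0 e_sym | apply: pie].
Qed.

Lemma strategy_iter_nbhd (V : finType) (e : rel V) k (s : cop_strategy V k) h i :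
  legal_strategy e s -> s h i \in iter (size h) (nbhd e) [set s [::] i].
Proof.
move=> s_legal; elim/last_ind: h => [|h x IH]; first by rewrite /= inE.
by rewrite size_rcons /=; apply: mem_nbhd IH _; apply: s_legal.
Qed.

End Combinatorics.

(** * Capture time *)

Section Game.
Set Implicit Arguments.
Unset Strict Implicit.
Unset Printing Implicit Defensive.
Local Open Scope nat_scope.
Local Open Scope set_scope.
Variables (R : realType) (V : finType) (e : rel V).
Hypothesis e_refl : reflexive e.

Lemma iter_nbhd_point (A : {set V}) j y :
  y \in iter j (nbhd e) A -> exists2 x, x \in A & y \in iter j (nbhd e) [set x]%SET.
Proof.
elim: j y => [|j IH] y /=; first by move=> yA; exists y => //; rewrite inE.
rewrite inE => /existsP[z /andP[/IH[x xA zx] ezy]].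
by exists x => //; apply: mem_nbhd zx ezy.
Qed.

(* Once the robber has started at [v], every cop walks to a vertex of the ball
   of radius [rho] around [v] so that together they cover this ball after
   [rho.+1] moves; by then the robber has made only [rho] moves. *)
Lemma capt_le_of_hall (k rho : nat) (f : {ffun 'I_k -> V}) :
  symmetric e -> 0 < k ->
  (forall v (A : {set V}), A \subset iter rho (nbhd e) [set v]%SET ->
     #|A| <= #|[set i | f i \in iter rho.+1 (nbhd e) A]%SET|) ->
  (capt R e k <= (rho.+1)%:R%:E)%E.
Proof.
move=> e_sym k0 hallf.
have /choice[P hP] : forall v, exists P : 'I_k -> nat -> V,
    [/\ forall i, P i 0 = f i, forall i t, e (P i t) (P i t.+1)
      & forall a, a \in iter rho (nbhd e) [set v]%SET -> exists i, P i rho.+1 = a].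
  (* The vertices of the ball are matched to cops at distance at most [rho.+1]. *)
  move=> v; have [|g gN gI] := @hall_marriage _ _
      (fun a => [set i | f i \in iter rho.+1 (nbhd e) [set a]%SET]%SET)
      (iter rho (nbhd e) [set v]%SET) (Ordinal k0).
    move=> A /hallf /leq_trans; apply; apply: subset_leq_card.
    apply/fintype.subsetP => i; rewrite inE => /iter_nbhd_point[a aA ia].
    by apply/bigcupP; exists a => //; rewrite inE.
  have /choice[P hP] : forall i, exists P : nat -> V,
      [/\ P 0 = f i, forall t, e (P t) (P t.+1) & forall a,
      a \in iter rho (nbhd e) [set v]%SET -> g a = i -> P rho.+1 = a].
    move=> i; have [[a aB gai]|none] := pselect (exists2 a,
        a \in iter rho (nbhd e) [set v]%SET & g a = i).
      have := gN a aB; rewrite inE gai => /(walk_of_iter_nbhd e_refl e_sym).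
      move=> [x]; rewrite inE => /eqP -> [P [P0 Pr Pe]]; exists P; split => //.
      by move=> a' a'B ga'i; rewrite Pr; apply: gI => //; rewrite gai.
    (* Unmatched cops never move. *)
    exists (fun=> f i); split => // a aB gai.
    by case: none; exists a.
  exists P; split=> [i|i|a aB]; [by case: (hP i)|by case: (hP i)|].
  by exists (g a); case: (hP (g a)) => _ _; apply.
(* Only the robber's starting vertex matters; [size h] is the number of the current round. *)
pose s : cop_strategy V k := fun h =>
  if h is v :: _ then [ffun i => P v i (size h)] else f.
apply: le_trans (_ : strategy_rounds R e s <= _)%E.
  apply: ereal_inf_lbound; exists s => //= -[|v h] x i /=; rewrite !ffunE.
    by case: (hP x) => P0 Pe _; rewrite -(P0 i).
  by rewrite size_rcons; case: (hP v).
apply: ge_ereal_sup => _ [w w_walk <-]; apply: ereal_inf_lbound.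
(* Capture happens right after the cops' move in round [rho.+1], with the robber still on
   [w rho]. *)
exists rho.+1 => //; have wr : w rho \in iter rho (nbhd e) [set w 0]%SET.
  by elim: (rho) => [|t IH]; [rewrite /= inE | apply: mem_nbhd IH (w_walk t)].
have [_ _ /(_ _ wr)[i Pi]] := hP (w 0).
by exists i; left; rewrite /= ffunE /= size_map size_iota.
Qed.

(** A robber who stays at a vertex farther than [m] from every starting cop survives round [m]. *)
Lemma le_capt_of_far (k m : nat) :
  (forall f : {ffun 'I_k -> V}, exists v, forall i, v \notin iter m (nbhd e) [set f i]%SET) ->
  ((m.+1)%:R%:E <= capt R e k)%E.
Proof.
move=> far; apply: le_ereal_inf_tmp => _ [s s_legal <-].
have [v vfar] := far (s [::]).
apply: le_trans (_ : rounds R s (fun=> v) <= _)%E; last first.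
  by apply: ereal_sup_ubound; exists (fun=> v) => // t; apply: e_refl.
apply: le_ereal_inf_tmp => _ [t [i cap] <-]; rewrite lee_fin ler_nat ltnNge.
apply/negP => tm; have /negP := vfar i; apply.
have <- : s (mkseq (fun=> v) t) i = v by case: cap.
apply: (fintype.subsetP (sub_iter_nbhd _ e_refl tm)).
by have := strategy_iter_nbhd (mkseq (fun=> v) t) i s_legal; rewrite size_mkseq.
Qed.

End Game.

(** * Exponential moments in G(n,p) *)

Section RandomGraph.
Set Implicit Arguments.
Unset Strict Implicit.
Unset Printing Implicit Defensive.
Local Open Scope bool_scope.
Local Open Scope set_scope.
Local Open Scope ring_scope.

Lemma sum_subsets_prod (R : comPzRingType) (I : finType) (P : {set I}) (g h : I -> R) :
  \sum_(E : {set I} | E \subset P) \prod_(a in P) (if a \in E then g a else h a)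
  = \prod_(a in P) (g a + h a).
Proof.
rewrite [RHS]big_mkcond /=.
(* A factor outside [P] is written as 0 + 1, so that expanding the product kills every [E] not
   contained in [P]. *)
under [RHS]eq_bigr => a _.
  rewrite (_ : (if _ then _ else _) =
    (if a \in P then g a else 0) + (if a \in P then h a else 1)); last first.
    by case: ifP; rewrite ?add0r.
  over.
rewrite bigA_distr [LHS]big_mkcond /=; apply: eq_bigr => E _; case: ifPn => [sEP|].
  rewrite big_mkcond /=; apply: eq_bigr => a _.
  by case: (boolP (a \in P)) => [//|aP]; rewrite (contraNF (fintype.subsetP sEP a)).
case/fintype.subsetPn => a aE aP; rewrite (bigD1 a) //= aE (negbTE aP).
by rewrite mul0r.
Qed.

Lemma sum_set_exp (R : comPzRingType) (I : finType) (w : R) :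
  \sum_(S : {set I}) w ^+ #|S| = (1 + w) ^+ #|I|.
Proof.
rewrite -prodr_const addrC (eq_bigl predT) // bigA_distr; apply: eq_bigr => S _.
by rewrite -prodr_const big_mkcond.
Qed.

Variables (R : realType) (n : nat) (p : R).
Hypothesis p01 : 0 <= p <= 1.

Definition gnp_mean (Y : {set {set 'I_n}} -> R) : R :=
  \sum_(E : {set {set 'I_n}} | E \subset pairs n)
    (\prod_(a in pairs n) (if a \in E then p else 1 - p)) * Y E.

Lemma gnp_weight_ge0 (E : {set {set 'I_n}}) :
  0 <= \prod_(a in pairs n) (if a \in E then p else 1 - p).
Proof. by apply: prodr_ge0 => a _; case/andP: p01 => p0 p1; case: ifP; rewrite ?subr_ge0. Qed.

(** Independence of the pairs. The moments below are reduced to this form. *)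
Lemma gnp_mean_prod (g h : {set 'I_n} -> R) :
  gnp_mean (fun E => \prod_(a in pairs n) (if a \in E then g a else h a)) =
  \prod_(a in pairs n) (p * g a + (1 - p) * h a).
Proof.
rewrite -sum_subsets_prod; apply: eq_bigr => E _; rewrite -big_split /=.
by apply: eq_bigr => a _; case: ifP.
Qed.

Lemma eq_gnp_mean (Y1 Y2 : {set {set 'I_n}} -> R) :
  (forall E : {set {set 'I_n}}, E \subset pairs n -> Y1 E = Y2 E) -> gnp_mean Y1 = gnp_mean Y2.
Proof. by move=> eqY; apply: eq_bigr => E sE; rewrite eqY. Qed.

Lemma gnp_mean_cst c : gnp_mean (fun=> c) = c.
Proof.
rewrite /gnp_mean -mulr_suml sum_subsets_prod big1 ?mul1r // => a _.
by rewrite addrC subrK.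
Qed.

Lemma gnp_meanZ c (Y : {set {set 'I_n}} -> R) :
  gnp_mean (fun E => c * Y E) = c * gnp_mean Y.
Proof. by rewrite /gnp_mean mulr_sumr; apply: eq_bigr => E _; rewrite mulrCA. Qed.

Lemma gnp_meanD (Y1 Y2 : {set {set 'I_n}} -> R) :
  gnp_mean (fun E => Y1 E + Y2 E) = gnp_mean Y1 + gnp_mean Y2.
Proof. by rewrite /gnp_mean -big_split; apply: eq_bigr => E _; rewrite mulrDr. Qed.

Lemma gnp_mean_sum (I : finType) (P : pred I) (Y : I -> {set {set 'I_n}} -> R) :
  gnp_mean (fun E => \sum_(i | P i) Y i E) = \sum_(i | P i) gnp_mean (Y i).
Proof. by rewrite /gnp_mean exchange_big; apply: eq_bigr => E _; rewrite mulr_sumr. Qed.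

(** Markov's inequality: [Y] is at least 1 wherever [A] fails. With [Y] a sum, it includes the union
    bound. *)
Lemma gnp_prob_ge (A : {set {set 'I_n}} -> Prop) (Y : {set {set 'I_n}} -> R) :
  (forall E, 0 <= Y E) -> (forall E : {set {set 'I_n}}, E \subset pairs n -> Y E < 1 -> A E) ->
  1 - gnp_mean Y <= gnp_prob p A.
Proof.
move=> Y0 YA; rewrite lerBlDr -(gnp_mean_cst 1) /gnp_mean /gnp_prob.
rewrite big_mkcondr -big_split /=; apply: ler_sum => E sE.
rewrite mulr1; case: (boolP `[< A E >]) => [_|/asboolPn nA].
  by rewrite lerDl mulr_ge0 ?gnp_weight_ge0.
rewrite add0r ler_peMr ?gnp_weight_ge0 // leNgt; apply/negP => Y1.
exact/nA/YA.
Qed.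

Lemma gnp_prob_le1 (A : {set {set 'I_n}} -> Prop) : gnp_prob p A <= 1.
Proof.
rewrite -(gnp_mean_cst 1) /gnp_mean /gnp_prob big_mkcondr /=.
apply: ler_sum => E _; rewrite mulr1; case: ifP => // _; exact: gnp_weight_ge0.
Qed.

Lemma pair_injective (x y y' : 'I_n) : y != x -> y' != x ->
  [set x; y] = [set x; y'] -> y = y'.
Proof.
move=> yx y'x /finset.setP/(_ y); rewrite !inE eqxx orbT (negbTE yx) /=.
by move/esym/eqP.
Qed.

Lemma pairs_through (x : 'I_n) :
  [set a in pairs n | x \in a] = [set [set x; y] | y in [set~ x]].
Proof.
apply/finset.setP => a; rewrite !inE; apply/andP/imsetP.
  move=> [/cards2P[u [v [uv ->]]]]; rewrite !inE => /orP[] /eqP ->.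
    by exists v; rewrite // !inE eq_sym.
  by exists u; rewrite ?inE // finset.setUC.
move=> [y]; rewrite !inE => yx ->; rewrite !inE eqxx; split => //.
by rewrite cards2 (eq_sym x) yx.
Qed.

Lemma radj_refl (E : {set {set 'I_n}}) : reflexive (radj E).
Proof. by move=> x; rewrite /radj eqxx. Qed.

Lemma radj_sym (E : {set {set 'I_n}}) : symmetric (radj E).
Proof. by move=> x y; rewrite /radj eq_sym finset.setUC. Qed.

(** The closed neighborhood has size 1 plus a binomial variable with parameters n - 1 and p; each
    factor 1 + u of the moment is bounded by exp u. *)
Lemma gnp_mean_exp_degree (t : R) (x : 'I_n) :
  gnp_mean (fun E => expR (t * #|nbhd (radj E) [set x]|%:R)) <=
  expR (t + p * (n%:R - 1) * (expR t - 1)).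
Proof.
have -> : gnp_mean (fun E => expR (t * #|nbhd (radj E) [set x]|%:R)) =
    gnp_mean (fun E => expR t * \prod_(a in pairs n)
      (if a \in E then (if x \in a then expR t else 1) else 1)).
  apply: eq_gnp_mean => E sE.
  have -> : nbhd (radj E) [set x] = x |: [set y in [set~ x] | [set x; y] \in E].
    apply/finset.setP => y; rewrite !inE; apply/existsP/idP.
      move=> [x' /andP[]]; rewrite inE => /eqP ->; rewrite /radj eq_sym.
      by case: eqP.
    move=> h; exists x; rewrite inE eqxx /= /radj eq_sym.
    by case/orP: h => [->//|/andP[_ ->]]; rewrite orbT.
  rewrite cardsU1 !inE eqxx /= natrD mulrDr mulr1 expRD; congr (_ * _).
  rewrite expRM_natr -prodr_const [LHS]big_mkcond /=.
  transitivity (\prod_(y in [set~ x]) (if [set x; y] \in E then expR t else 1)).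
    rewrite [RHS]big_mkcond /=; apply: eq_bigr => y _; rewrite !inE.
    by case: eqP.
  rewrite -(big_imset (fun a => if a \in E then expR t else 1)) /=; last first.
    by move=> y y'; rewrite !inE; exact: pair_injective.
  rewrite -pairs_through big_mkcond [RHS]big_mkcond /=; apply: eq_bigr => a _.
  by rewrite inE; case: (a \in pairs n); case: (x \in a); case: (a \in E).
rewrite gnp_meanZ gnp_mean_prod expRD ler_wpM2l ?expR_ge0 //.
have -> : \prod_(a in pairs n) (p * (if x \in a then expR t else 1) + (1 - p) * 1) =
    \prod_(a in [set a in pairs n | x \in a]) (1 + p * (expR t - 1)).
  rewrite big_mkcond [RHS]big_mkcond /=; apply: eq_bigr => a _; rewrite [in RHS]inE.
  by case: (a \in pairs n) => //=; case: (x \in a); ring.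
rewrite pairs_through big_imset /=; last first.
  by move=> y y'; rewrite !inE; exact: pair_injective.
rewrite prodr_const cardsC1 card_ord.
have -> : p * (n%:R - 1) * (expR t - 1) = (p * (expR t - 1)) *+ n.-1.
  case: n x => [[//]|m x] /=; rewrite -mulr_natr -natr1; ring.
rewrite -mulr_natr expRM_natr.
apply: lerXn2r; rewrite ?nnegrE ?expR_ge0 ?expR_ge1Dx //.
by case/andP: p01 => p0 p1; have := expR_ge0 t; nra.
Qed.

(** If [U] meets [S] the event is impossible, since S lies in N[S]. Otherwise it says that none of
    the |S| |U| distinct pairs between [S] and [U] is an edge. The product over [U] is the form that
    the next lemma sums. *)
Lemma gnp_mean_disjoint_nbhd (S U : {set 'I_n}) :
  gnp_mean (fun E => [disjoint U & nbhd (radj E) S]%:R) =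
  \prod_(y in U) (if y \in S then 0 else (1 - p) ^+ #|S|).
Proof.
have [[y yU yS]|dis] := pselect (exists2 y, y \in U & y \in S).
  rewrite (bigD1 y) //= yS mul0r -[RHS](gnp_mean_cst 0); apply: eq_gnp_mean => E _.
  case: (boolP [disjoint U & _]) => // /disjointFr/(_ yU) yN.
  by have := mem_nbhd yS (radj_refl E y); rewrite yN.
have disU y : y \in U -> y \in S = false.
  by move=> yU; apply/negP => yS; apply: dis; exists y.
pose cut := [set [set xy.1; xy.2] | xy in finset.setX S U].
have cutP a : reflect (exists x y, [/\ x \in S, y \in U & a = [set x; y]]) (a \in cut).
  apply: (iffP imsetP) => [[[x y]]|[x [y [xS yU ->]]]].
    by rewrite inE /= => /andP[xS yU] ->; exists x, y.
  by exists (x, y) => //; rewrite inE /= xS.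
have -> : gnp_mean (fun E => [disjoint U & nbhd (radj E) S]%:R) =
    gnp_mean (fun E => \prod_(a in pairs n)
      (if a \in E then (if a \in cut then 0 else 1) else 1)).
  apply: eq_gnp_mean => E sE; case: (boolP [disjoint U & _]) => [/disjointFr h|].
    rewrite big1 // => a _; case: ifP => // aE; case: ifP => // /cutP[x [y [xS yU ae]]].
    suff: y \in nbhd (radj E) S by rewrite h.
    apply: mem_nbhd xS _.
    by rewrite /radj -ae aE orbT.
  rewrite -setI_eq0 => /set0Pn[y]; rewrite !inE => /andP[yU /existsP[x /andP[xS]]].
  rewrite /radj; case: eqP => [xy|_ /= aE]; first by rewrite xy disU in xS.
  rewrite (bigD1 [set x; y]) /=; last exact: (fintype.subsetP sE).
  rewrite aE ifT ?mul0r //.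
  by apply/cutP; exists x, y.
rewrite gnp_mean_prod.
transitivity (\prod_(a in cut) (1 - p)).
  rewrite big_mkcond [RHS]big_mkcond /=; apply: eq_bigr => a _.
  case: (boolP (a \in cut)) => [|_]; last by case: ifP => _ //; ring.
  case/cutP => x [y [xS yU ->]]; rewrite inE cards2.
  rewrite (_ : x != y) /=; first by ring.
  by apply: contraTneq xS => ->; rewrite disU.
rewrite prodr_const card_in_imset.
  rewrite cardsX exprM -prodr_const.
  by apply: eq_bigr => y yU; rewrite disU.
move=> [x y] [x' y']; rewrite !inE /= => /andP[xS yU] /andP[x'S y'U] e.
move/finset.setP: (e) => /(_ x); rewrite !inE eqxx /= => /esym/orP[/eqP xx'|/eqP xy']; last first.
  by rewrite xy' disU in xS.
subst x'; congr (_, _); have yx z : z \in U -> z != x.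
  by move=> zU; apply: contraTneq xS => <-; rewrite disU.
by apply: pair_injective e; apply: yx.
Qed.

(** Let a random set T contain each vertex independently with probability z. Then z^|N[S]| is the
    probability that T contains N[S], that is, that the complement of T misses N[S]. Averaging over
    the graph first and then over T gives a product over vertices, where [r y] is the probability
    that y is not in N[S]. *)
Lemma gnp_mean_exp_nbhd (z q : R) (S : {set 'I_n}) :
  0 <= z <= 1 -> q <= 1 - (1 - p) ^+ #|S| ->
  gnp_mean (fun E => z ^+ #|nbhd (radj E) S|) <= expR (- ((1 - z) * q * n%:R)).
Proof.
move=> /andP[z0 z1] qle; pose r y := if y \in S then 0 else (1 - p) ^+ #|S|.
have -> : gnp_mean (fun E => z ^+ #|nbhd (radj E) S|) = \prod_y (z + (1 - z) * r y).
  have -> : gnp_mean (fun E => z ^+ #|nbhd (radj E) S|) =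
      gnp_mean (fun E => \sum_(T : {set 'I_n})
        (\prod_y (if y \in T then z else 1 - z)) * [disjoint ~: T & nbhd (radj E) S]%:R).
    apply: eq_gnp_mean => E sE; rewrite -prodr_const big_mkcond /=.
    transitivity (\prod_y (z + (if y \in nbhd (radj E) S then 0 else 1 - z))).
      by apply: eq_bigr => y _; case: ifP => _; ring.
    rewrite bigA_distr; apply: eq_bigr => T _.
    case: (boolP [disjoint _ & _]) => [/disjointFr h|].
      rewrite mulr1; apply: eq_bigr => y _; case: ifPn => // yT.
      by rewrite h // inE.
    rewrite -setI_eq0 mulr0 => /set0Pn[y]; rewrite inE [y \in ~: T]inE.
    by move=> /andP[yT yN]; rewrite (bigD1 y) //= (negbTE yT) yN mul0r.
  rewrite gnp_mean_sum bigA_distr; apply: eq_bigr => T _.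
  rewrite gnp_meanZ gnp_mean_disjoint_nbhd [X in _ * X]big_mkcond -big_split /=.
  by apply: eq_bigr => y _; rewrite !inE; case: ifP => _; rewrite ?mulr1.
have q0 : 0 <= (1 - p) ^+ #|S| by apply: exprn_ge0; case/andP: p01; lra.
have -> : expR (- ((1 - z) * q * n%:R)) = \prod_(y : 'I_n) expR (- ((1 - z) * q)).
  by rewrite prodr_const card_ord -expRM_natr mulNr.
apply: ler_prod => y _; rewrite /r; apply/andP; split.
  by case: ifP => _; nra.
apply: le_trans (expR_ge1Dx _).
by case: ifP => _; nra.
Qed.

End RandomGraph.

(** * Chernoff bounds for degrees and neighborhoods *)

Section GoodGraph.
Set Implicit Arguments.
Unset Strict Implicit.
Unset Printing Implicit Defensive.
Local Open Scope bool_scope.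
Local Open Scope set_scope.
Local Open Scope ring_scope.
Variable R : realType.

(** From exp(-u) >= 1 - u one gets exp(u) (1 - u) <= 1 <= (1 + u + 2 u^2)(1 - u). There is no lower
    bound on u, so this serves both tails. *)
Lemma expR_le_quadratic (u : R) : u <= 1 / 2 -> expR u <= 1 + u + 2 * u ^+ 2.
Proof.
move=> u2; have := expR_ge1Dx (- u); have := expRxMexpNx_1 u.
have : 0 <= u ^+ 2 * (1 - 2 * u) by apply: mulr_ge0; [apply: sqr_ge0 | lra].
have := expR_ge0 u.
set x := expR u; set y := expR (- u); move=> x0 u0 xy y1.
have h : x * (1 - u) <= (1 + u + 2 * u ^+ 2) * (1 - u).
  apply: (@le_trans _ _ 1); first by rewrite -[leRHS]xy ler_wpM2l.
  rewrite (_ : _ * _ = 1 + u ^+ 2 * (1 - 2 * u)); [by rewrite lerDl | by ring].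
by rewrite ler_pM2r in h; lra.
Qed.

(** The right side is 1 / (1 + p s). The resulting bound p s / (1 + p s) on the chance of having a
    neighbor among s vertices has an inverse that is affine in 1 / s, which later makes the
    recursion linear. *)
Lemma exprn_subr1_le (p : R) (s : nat) : 0 <= p <= 1 ->
  (1 - p) ^+ s <= 1 - p * s%:R / (1 + p * s%:R).
Proof.
move=> /andP[p0 p1]; have ps0 m : 0 <= p * m%:R :> R by rewrite mulr_ge0.
have h m : (1 - p) ^+ m * (1 + p * m%:R) <= 1.
  elim: m => [|m IH]; first by rewrite expr0 mulr0 addr0 mul1r.
  apply: le_trans IH; rewrite exprSr -mulrA ler_wpM2l ?exprn_ge0 ?subr_ge0 //.
  by rewrite -natr1; have := ps0 m; nra.
have q0 : 0 < 1 + p * s%:R by have := ps0 s; lra.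
have -> : 1 - p * s%:R / (1 + p * s%:R) = (1 + p * s%:R)^-1 by field; apply: lt0r_neq0.
by rewrite -[leRHS]mul1r ler_pdivlMr.
Qed.

(** The total of a union bound in which each nonempty S fails with probability at most n^(-2|S|): it
    is (1 + n^(-2))^n - 1. *)
Lemma sum_nonempty_set_exp_le (I : finType) : (2 <= #|I|)%N ->
  \sum_(S : {set I} | S != finset.set0) ((#|I|%:R ^+ 2)^-1 : R) ^+ #|S| <= 3 / #|I|%:R.
Proof.
move=> n2; set n := #|I|; set w : R := _^-1.
have n0 : 0 < n%:R :> R by rewrite ltr0n; apply: leq_trans n2.
have := sum_set_exp I w; rewrite (bigD1 finset.set0) //= cards0 expr0.
move=> /(canRL (addKr _)) ->; have nV : n%:R^-1 <= 1 / 2 :> R.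
  by rewrite div1r lef_pV2 ?posrE // ler_nat.
have nw : n%:R * w = n%:R^-1.
  by rewrite /w; field; apply: lt0r_neq0.
have h : (1 + w) ^+ n <= expR n%:R^-1.
  rewrite -nw expRM_natl; apply: lerXn2r; rewrite ?nnegrE ?expR_ge0 ?expR_ge1Dx //.
  by rewrite addr_ge0 // invr_ge0 exprn_ge0 // ltW.
rewrite addrC lerBlDr; apply: le_trans h _; apply: le_trans (expR_le_quadratic nV) _.
have : 0 < n%:R^-1 :> R by rewrite invr_gt0.
set y := n%:R^-1; move=> y0; have : y ^+ 2 <= y * (1 / 2) by rewrite expr2 ler_pM2l.
lra.
Qed.

(** The deterministic properties kept from the random graph. Sets with p |S| > 1 are later handled
    through a subset of size about 1 / p. *)
Definition tame_graph (n : nat) (p eps : R) (e : rel 'I_n) : Prop :=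
  (forall x, #|nbhd e [set x]|%:R <= (1 + 2 * eps) * (p * (n%:R - 1))) /\
  (forall S : {set 'I_n}, S != finset.set0 -> p * #|S|%:R <= 1 ->
     (1 - eps) * n%:R * (p * #|S|%:R / (1 + p * #|S|%:R)) <= #|nbhd e S|%:R).

(** Chernoff bounds: a vertex fails with probability at most n^(-2) and a set S with at most
    n^(-2|S|), for a total of at most 1/n + 3/n. *)
Lemma gnp_tame (n : nat) (p : R) (A : {set {set 'I_n}} -> Prop) :
  let L := ln n%:R in
  0 <= p <= 1 -> 12 <= L -> L ^+ 3 <= p * (n%:R - 1) ->
  (forall E, tame_graph p (6 / L) (radj E) -> A E) ->
  1 - 4 / n%:R <= gnp_prob p A.
Proof.
move=> L p01 L12 dL tameA; set d := p * (n%:R - 1) in dL *.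
have L0 : 0 < L by lra.
have n2 : (2 <= n)%N.
  rewrite ltnNge; apply/negP; rewrite -(ler_nat R) => /ln_le0; rewrite -/L; lra.
have n0 : 0 < n%:R :> R by rewrite ltr0n; apply: leq_trans n2.
(* This [t] minimizes - t eps + 2 t^2, with value - eps^2 / 8. The constant 6 gives d eps^2 >= 36 L,
   so the exponent for [S] is at most - (36/16) L |S|, below - 2 L |S|. *)
pose eps := 6 / L; pose t := eps / 4.
have e0 : 0 < eps by rewrite divr_gt0.
have e1 : eps <= 1 / 2 by rewrite ler_pdivrMr //; lra.
have d0 : 0 < d by apply: lt_le_trans dL; rewrite exprn_gt0.
have deps : 36 * L <= d * eps ^+ 2.
  rewrite (_ : d * eps ^+ 2 = 36 * (d / L ^+ 2)); last by rewrite /eps; field; apply: lt0r_neq0.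
  by rewrite ler_pM2l ?ltr0n // ler_pdivlMr ?exprn_gt0 // -exprS.
(* This absorbs the vertex itself: 1 + (1 + eps) d <= (1 + 2 eps) d. *)
have deps1 : 1 <= d * eps.
  have : d * eps ^+ 2 <= d * eps * (1 / 2) by rewrite expr2 mulrA ler_wpM2l // mulr_ge0 // ltW.
  lra.
have nL : expR (- (2 * L)) = (n%:R ^+ 2)^-1 :> R.
  by rewrite expRN expRM_natl lnK // posrE.
pose q (S : {set 'I_n}) := p * #|S|%:R / (1 + p * #|S|%:R).
pose Y1 (x : 'I_n) (E : {set {set 'I_n}}) :=
  expR (- (t * (1 + (1 + eps) * d))) * expR (t * #|nbhd (radj E) [set x]|%:R).
pose Y2 (S : {set 'I_n}) (E : {set {set 'I_n}}) :=
  expR (t * ((1 - eps) * n%:R * q S)) * expR (- t) ^+ #|nbhd (radj E) S|.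
pose P (S : {set 'I_n}) := (S != finset.set0) && (p * #|S|%:R <= 1).
pose Y E := \sum_x Y1 x E + \sum_(S | P S) Y2 S E.
have Y10 x E : 0 <= Y1 x E by rewrite mulr_ge0 ?expR_ge0.
have Y20 S E : 0 <= Y2 S E by rewrite mulr_ge0 ?exprn_ge0 ?expR_ge0.
have t0 : 0 < t by rewrite divr_gt0.
have mean1 x : gnp_mean p (Y1 x) <= (n%:R ^+ 2)^-1.
  rewrite gnp_meanZ -nL; apply: le_trans (ler_wpM2l (expR_ge0 _) (gnp_mean_exp_degree p01 t x)) _.
  rewrite -expRD ler_expR -/d.
  have tq : expR t <= 1 + t + 2 * t ^+ 2 by apply: expR_le_quadratic; rewrite /t; lra.
  have : d * (expR t - 1) <= d * (t + 2 * t ^+ 2) by rewrite ler_wpM2l ?(ltW d0) //; lra.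
  have -> : d * (t + 2 * t ^+ 2) = t * d + (d * eps ^+ 2) / 8 by rewrite /t; field.
  have : t * eps * d = (d * eps ^+ 2) / 4 by rewrite /t; field.
  lra.
have mean2 S : P S -> gnp_mean p (Y2 S) <= ((n%:R ^+ 2)^-1) ^+ #|S|.
  move=> /andP[S0 pS]; have s0 : 0 < #|S|%:R :> R by rewrite ltr0n card_gt0.
  have p0 : 0 <= p by case/andP: p01.
  have ps0 : 0 <= p * #|S|%:R by rewrite mulr_ge0 // ltW.
  rewrite gnp_meanZ -nL -expRM_natr.
  have z01 : 0 <= expR (- t) <= 1 by rewrite expR_ge0 expR_le1; lra.
  have qle : q S <= 1 - (1 - p) ^+ #|S| by rewrite lerBrDl -lerBrDr exprn_subr1_le.
  apply: le_trans (ler_wpM2l (expR_ge0 _) (gnp_mean_exp_nbhd p01 z01 qle)) _.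
  rewrite -expRD ler_expR.
  have tq : expR (- t) <= 1 - t + 2 * t ^+ 2.
    by have := @expR_le_quadratic (- t); rewrite sqrrN; apply; lra.
  have nq0 : 0 <= q S * n%:R by apply: mulr_ge0 => //; apply: divr_ge0 => //; lra.
  have nq : d * #|S|%:R / 2 <= q S * n%:R.
    apply: (@le_trans _ _ (p * n%:R * #|S|%:R / 2)).
      by rewrite ler_pM2r ?invr_gt0 // ler_pM2r // /d ler_wpM2l // lerBlDr lerDl.
    rewrite (_ : p * n%:R * #|S|%:R / 2 = (p * #|S|%:R / 2) * n%:R); last by ring.
    rewrite ler_pM2r // /q ler_wpM2l // lef_pV2 ?posrE; lra.
  have h1 : q S * n%:R * (t - 2 * t ^+ 2) <= q S * n%:R * (1 - expR (- t)) by rewrite ler_wpM2l //; lra.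
  have h2 : d * #|S|%:R / 2 * (eps ^+ 2 / 8) <= q S * n%:R * (eps ^+ 2 / 8).
    by rewrite ler_wpM2r // divr_ge0 ?sqr_ge0.
  have h3 : 36 * L * (#|S|%:R / 16) <= d * eps ^+ 2 * (#|S|%:R / 16).
    by rewrite ler_wpM2r // divr_ge0 // ltW.
  have h4 : 0 <= L * #|S|%:R by rewrite mulr_ge0 // ltW.
  have -> : t * ((1 - eps) * n%:R * q S) + - ((1 - expR (- t)) * q S * n%:R) =
     (q S * n%:R * (t - 2 * t ^+ 2) - q S * n%:R * (1 - expR (- t))) - q S * n%:R * (eps ^+ 2 / 8).
    by rewrite /t; field.
  move: h2 h3 h1; rewrite (_ : d * _ / 2 * _ = d * eps ^+ 2 * (#|S|%:R / 16)); last by field.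
  lra.
apply: le_trans (gnp_prob_ge p01 (Y := Y) _ _); last 2 first.
- by move=> E; rewrite addr_ge0 ?sumr_ge0.
- move=> E _ YE; apply: tameA; split=> [x|S S0 pS].
    have : Y1 x E < 1.
      apply: le_lt_trans YE; rewrite /Y (bigD1 x) //= -addrA lerDl.
      by rewrite addr_ge0 ?sumr_ge0.
    rewrite /Y1 -expRD expR_lt1 -/d -/eps => h.
    have : t * #|nbhd (radj E) [set x]|%:R < t * (1 + (1 + eps) * d) by lra.
    rewrite ltr_pM2l // => /ltW/le_trans; apply; lra.
  have : Y2 S E < 1.
    apply: le_lt_trans YE; rewrite /Y (bigD1 S (P := P)) /=; last by apply/andP.
    by rewrite addrCA lerDl addr_ge0 ?sumr_ge0.
  rewrite /Y2 -expRM_natr -expRD expR_lt1 -/eps mulNr subr_lt0 ltr_pM2l //.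
  exact: ltW.
rewrite lerD2l lerN2 gnp_meanD !gnp_mean_sum.
have s1 : \sum_x gnp_mean p (Y1 x) <= 1 / n%:R.
  apply: le_trans (ler_sum _ (fun x _ => mean1 x)) _.
  by rewrite sumr_const card_ord -[leLHS]mulr_natr expr2 invfM -mulrA mulVf ?mulr1 ?div1r // lt0r_neq0.
have s2 : \sum_(S | P S) gnp_mean p (Y2 S) <= 3 / n%:R.
  apply: le_trans (ler_sum _ mean2) _.
  have := @sum_nonempty_set_exp_le 'I_n; rewrite card_ord => /(_ n2); apply: le_trans.
  by rewrite big_mkcondr /=; apply: ler_sum => S _; case: ifP.
lra.
Qed.

End GoodGraph.

(** * Placement of the cops and expansion *)

Section Capture.
Set Implicit Arguments.
Unset Strict Implicit.
Unset Printing Implicit Defensive.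
Local Open Scope bool_scope.
Local Open Scope set_scope.
Local Open Scope ring_scope.
Variable R : realType.

(* If the cops are placed independently and uniformly, then Markov's inequality
   for [expR (- #|...|)] and a union bound over [S] leave some placement. *)
Lemma exists_spread_placement (V : finType) (k : nat) (Nb : {set V} -> {set V})
    (P : pred {set V}) : (4 <= #|V|)%N ->
  (forall S, P S -> S != finset.set0 ->
     8 * ln (#|V|%:R : R) * #|S|%:R <= k%:R * #|Nb S|%:R / #|V|%:R) ->
  exists f : {ffun 'I_k -> V}, forall S, P S -> S != finset.set0 ->
    k%:R * #|Nb S|%:R / (4 * #|V|%:R) <= #|[set i | f i \in Nb S]|%:R :> R.
Proof.
move=> n4 largeN; set n := #|V| in n4 largeN *.
have n0 : 0 < n%:R :> R by rewrite ltr0n; apply: leq_trans n4.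
pose X (f : {ffun 'I_k -> V}) S := #|[set i | f i \in Nb S]|.
pose Y f S : R := expR (k%:R * #|Nb S|%:R / (4 * n%:R)) * expR (- 1) ^+ X f S.
pose Q S := (S != finset.set0) && P S.
apply: contrapT => /forallNP bad.
have Y0 f S : 0 <= Y f S by rewrite mulr_ge0 ?exprn_ge0 ?expR_ge0.
have Y1 f : 1 <= \sum_(S | Q S) Y f S.
  have /existsNP[S /not_implyP[PS /not_implyP[S0 /negP]]] := bad f.
  rewrite -ltNge => /ltW XS; rewrite (bigD1 S) /=; last by rewrite /Q S0 PS.
  apply: le_trans (_ : Y f S <= _); last by rewrite lerDl sumr_ge0.
  by rewrite /Y -expRM_natr -expRD -[leLHS]expR0 ler_expR mulN1r subr_ge0.
have e2 : expR (- 1) <= 1 / 2 :> R.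
  rewrite expRN div1r lef_pV2 ?posrE ?expR_gt0 //.
  by have := expR_ge1Dx (1 : R); lra.
(* The exponent is k|Nb S|/(4n) - k|Nb S|/(2n), which [largeN] bounds by - 2 |S| log n. *)
have mean S : Q S -> \sum_f Y f S <= n%:R ^+ k * ((n%:R ^+ 2)^-1) ^+ #|S|.
  move=> /andP[S0 PS]; rewrite -mulr_sumr.
  have -> : \sum_f expR (- 1) ^+ X f S =
      (\sum_y (if y \in Nb S then expR (- 1) else 1 : R)) ^+ k.
    rewrite -[k in RHS]card_ord -prodr_const bigA_distr_bigA; apply: eq_bigr => f _.
    rewrite -prodr_const big_mkcond /=; apply: eq_bigr => i _.
    by rewrite inE.
  have -> : \sum_y (if y \in Nb S then expR (- 1) else 1 : R) =
      n%:R - (1 - expR (- 1)) * #|Nb S|%:R.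
    transitivity (\sum_y ((1 : R) - (if y \in Nb S then 1 - expR (- 1) else 0))).
      by apply: eq_bigr => y _; case: ifP => _; ring.
    by rewrite big_split /= sumrN -big_mkcond /= !sumr_const mulr_natr -/n.
  set s := #|Nb S|%:R; have s0 : 0 <= s by rewrite ler0n.
  have sn : s <= n%:R by rewrite ler_nat max_card.
  have base : n%:R - (1 - expR (- 1)) * s <= n%:R * expR (- (s / n%:R / 2)).
    have := ler_wpM2l (ltW n0) (expR_ge1Dx (- (s / n%:R / 2))); apply: le_trans.
    rewrite (_ : n%:R * _ = n%:R - s / 2); last by field; apply: lt0r_neq0.
    by nra.
  have base0 : 0 <= n%:R - (1 - expR (- 1)) * s by have := expR_ge0 (- 1 : R); nra.
  have hk : (n%:R - (1 - expR (- 1)) * s) ^+ k <= (n%:R * expR (- (s / n%:R / 2))) ^+ k.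
    by apply: lerXn2r; rewrite ?nnegrE // (le_trans base0).
  apply: le_trans (ler_wpM2l (expR_ge0 _) hk) _.
  rewrite exprMn mulrCA ler_wpM2l ?exprn_ge0 ?ler0n //.
  rewrite -expRM_natl -expRD.
  rewrite (_ : (n%:R ^+ 2)^-1 = expR (- (2 * ln n%:R))); last first.
    by rewrite expRN expRM_natl lnK.
  rewrite -expRM_natr ler_expR; have := largeN S PS S0; rewrite -/s.
  rewrite (_ : k%:R * s / (4 * n%:R) + _ = - (k%:R * s / n%:R / 4)); last first.
    by field; apply: lt0r_neq0.
  lra.
(* If all n^k placements were bad, the double sum would be at least n^k; it is at most n^k times 3 /
   n. *)
have : \sum_(f : {ffun 'I_k -> V}) (1 : R) <= \sum_f \sum_(S | Q S) Y f S by apply: ler_sum.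
rewrite sumr_const card_ffun card_ord natrX leNgt => /negP; apply.
rewrite exchange_big /=; apply: le_lt_trans (ler_sum _ mean) _.
rewrite -mulr_sumr -[ltRHS]mulr1 ltr_pM2l ?exprn_gt0 //.
apply: le_lt_trans (_ : 3 / n%:R < 1).
  have n2 : (2 <= n)%N by apply: leq_trans n4.
  apply: le_trans (sum_nonempty_set_exp_le R n2).
  by rewrite big_mkcondr /=; apply: ler_sum => S _; case: ifP.
by rewrite ltr_pdivrMr // mul1r ltr_nat.
Qed.

Section Tame.
Variables (n : nat) (p eps : R) (e : rel 'I_n).
Hypotheses (p01 : 0 < p <= 1) (eps01 : 0 < eps <= 1 / 2) (n2 : (2 <= n)%N).
Hypotheses (e_refl : reflexive e) (e_tame : tame_graph p eps e).
Let d := p * (n%:R - 1).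

Let n0 : 0 < n%:R :> R.
Proof. by rewrite ltr0n; apply: leq_trans n2. Qed.

Let d0 : 0 < d.
Proof.
have n1 : 2 <= n%:R :> R by rewrite ler_nat.
by case/andP: p01 => p0 _; apply: mulr_gt0 => //; lra.
Qed.

(* Passing to inverses linearizes [s |-> n p s / (1 + p s)]. *)
Lemma tame_inv_card_nbhd (S : {set 'I_n}) : S != finset.set0 ->
  #|nbhd e S|%:R^-1 <= (1 + 2 * eps) / (d * #|S|%:R) + 6 / n%:R.
Proof.
move=> S0; case/andP: p01 => p0 p1; case/andP: eps01 => e0 e1.
have s0 : 0 < #|S|%:R :> R by rewrite ltr0n card_gt0.
have c0 : 0 < 1 - eps by lra.
have [ps|ps] := leP (p * #|S|%:R) 1.
  have ps0 : 0 < p * #|S|%:R by rewrite mulr_gt0.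
  have [_ /(_ S S0 ps) h] := e_tame.
  have q0 : 0 < (1 - eps) * n%:R * (p * #|S|%:R / (1 + p * #|S|%:R)).
    by rewrite !mulr_gt0 ?invr_gt0 //; lra.
  have N0 := lt_le_trans q0 h.
  apply: le_trans (_ : ((1 - eps) * n%:R * (p * #|S|%:R / (1 + p * #|S|%:R)))^-1 <= _).
    by rewrite lef_pV2 ?posrE.
  have -> : ((1 - eps) * n%:R * (p * #|S|%:R / (1 + p * #|S|%:R)))^-1 =
      (1 - eps)^-1 * ((n%:R * (p * #|S|%:R))^-1 + n%:R^-1).
    by field; rewrite !lt0r_neq0 // addr_gt0.
  have ce : (1 - eps)^-1 <= 1 + 2 * eps.
    by rewrite -[leLHS]mul1r ler_pdivrMr //; nra.
  have dn : (n%:R * (p * #|S|%:R))^-1 <= (d * #|S|%:R)^-1.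
    have ds0 : 0 < d * #|S|%:R by apply: mulr_gt0.
    rewrite lef_pV2 ?posrE //; last exact: mulr_gt0.
    rewrite mulrA ler_pM2r // /d mulrC.
    by rewrite ler_pM2r // lerBlDr lerDl.
  apply: le_trans (_ : (1 + 2 * eps) * ((d * #|S|%:R)^-1 + n%:R^-1) <= _).
    have X0 : 0 <= (n%:R * (p * #|S|%:R))^-1 + n%:R^-1 :> R.
      by rewrite addr_ge0 // invr_ge0 ltW // mulr_gt0.
    by apply: ler_pM => //; [rewrite invr_ge0 ltW | rewrite lerD2r].
  rewrite mulrDr lerD2l ler_pM2r ?invr_gt0 //; lra.
(* A subset of m = floor(1/p) vertices has p m > 1/2, so its neighborhood already has at least (1/2)
   n (1/3) = n / 6 vertices. *)
pose m := Num.truncn p^-1.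
have /andP[mp pm] : m%:R <= p^-1 < m.+1%:R by apply: truncn_itv; rewrite invr_ge0 ltW.
have m1 : (1 <= m)%N.
  by rewrite -ltnS -(ltr_nat R); apply: le_lt_trans pm; rewrite -[leLHS]invr1 lef_pV2 ?posrE.
have pm1 : p * m%:R <= 1 by rewrite mulrC -ler_pdivlMr // div1r.
have pm2 : 1 < p * m%:R + p.
  have : p * p^-1 < p * m.+1%:R by rewrite ltr_pM2l.
  by rewrite mulfV ?lt0r_neq0 // -natr1 mulrDr mulr1.
have pm3 : p <= p * m%:R by rewrite ler_peMr ?(ltW p0) // ler1n.
have ms : (m <= #|S|)%N.
  by rewrite -(ler_nat R); apply: le_trans mp _; rewrite -div1r ler_pdivrMr // mulrC ltW.
have [S' sS' cS'] := subset_of_card ms.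
have S'0 : S' != finset.set0 by rewrite -card_gt0 cS'.
have [_ /(_ S' S'0)] := e_tame; rewrite cS' => /(_ pm1) h.
have hq : 1 / 3 <= p * m%:R / (1 + p * m%:R) by rewrite ler_pdivlMr; lra.
have N6 : n%:R / 6 <= #|nbhd e S|%:R :> R.
  apply: (@le_trans _ _ (#|nbhd e S'|%:R)); last by rewrite ler_nat subset_leq_card ?nbhdS.
  apply: le_trans h; apply: (@le_trans _ _ ((1 / 2 * n%:R) * (1 / 3))); first by lra.
  by apply: ler_pM => //; rewrite ler_pM2r //; lra.
apply: le_trans (_ : (n%:R / 6)^-1 <= _).
  by rewrite lef_pV2 ?posrE ?divr_gt0 //; apply: lt_le_trans N6; rewrite divr_gt0.
by rewrite invf_div lerDr; apply: divr_ge0; [lra | rewrite ltW // mulr_gt0].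
Qed.

(** The recursion is x' <= a x + 6/n with a <= 1/2, so the additive error never exceeds 12/n. *)
Lemma tame_inv_card_iter_nbhd (S : {set 'I_n}) j : S != finset.set0 ->
  (1 + 2 * eps) / d <= 1 / 2 ->
  #|iter j (nbhd e) S|%:R^-1 <= ((1 + 2 * eps) / d) ^+ j / #|S|%:R + 12 / n%:R.
Proof.
move=> S0 a2; case/andP: eps01 => e0 e1.
elim: j => [|j IH] /=; first by rewrite expr0 div1r lerDl divr_ge0 // ltW.
set T := iter j _ _ in IH *.
have T0 : T != finset.set0.
  apply: contraNneq S0 => T0; rewrite -finset.subset0 -T0.
  exact: (sub_iter_nbhd _ e_refl (leq0n j)).
apply: le_trans (tame_inv_card_nbhd T0) _.
set a := (1 + 2 * eps) / d in a2 IH *.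
have a0 : 0 <= a by rewrite divr_ge0 ?(ltW d0) //; lra.
have -> : (1 + 2 * eps) / (d * #|T|%:R) = a * #|T|%:R^-1 by rewrite /a invfM mulrA.
have := ler_wpM2l a0 IH; rewrite mulrDr mulrA -exprS => h.
have : a * (12 / n%:R) <= 1 / 2 * (12 / n%:R) by rewrite ler_wpM2r // divr_ge0 // ltW.
lra.
Qed.

(** By the degree bound, the balls of radius [m] around the cops have fewer than [n] vertices in
    total. *)
Lemma tame_le_capt (k m : nat) :
  k%:R * ((1 + 2 * eps) * d) ^+ m < n%:R -> ((m.+1)%:R%:E <= capt R e k)%E.
Proof.
case/andP: eps01 => e_pos _ small; apply: le_capt_of_far => // f.
pose U := \bigcup_(i : 'I_k) iter m (nbhd e) [set f i].
have ltU : (#|U| < n)%N.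
  rewrite -(ltr_nat R); apply: le_lt_trans small; rewrite mulrC mulr_natr.
  have -> : ((1 + 2 * eps) * d) ^+ m *+ k =
      \sum_(i : 'I_k) ((1 + 2 * eps) * d) ^+ m by rewrite sumr_const card_ord.
  apply: le_trans (_ : (\sum_(i : 'I_k) #|iter m (nbhd e) [set f i]|)%N%:R <= _).
    rewrite ler_nat /U; elim/big_ind2: _ => [|m1 B1 m2 B2 h1 h2|//]; first by rewrite cards0.
    by rewrite cardsU (leq_trans (leq_subr _ _)) // leq_add.
  rewrite natr_sum; apply: ler_sum => i _.
  have [deg _] := e_tame; have := card_iter_nbhd_le [set f i] m deg.
  by rewrite cards1 mulr1.
have /fintype.subsetPn[v _ vU] : ~~ ([set: 'I_n]%SET \subset U).
  by apply/negP => /subset_leq_card; rewrite cardsT card_ord leqNgt ltU.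
by exists v => i; apply: contra vU => vi; apply/bigcupP; exists i.
Qed.

End Tame.
End Capture.

(** * Bounds on the capture time *)

Section Logarithmic.
Set Implicit Arguments.
Unset Strict Implicit.
Unset Printing Implicit Defensive.
Variables (R : realType) (n : nat) (d : R).
Let L : R := ln n%:R.
Hypotheses (L12 : 12 <= L) (dL : L ^+ 3 <= d).

Lemma ln_ge12_nat_gt : (12 < n)%N.
Proof.
rewrite ltnNge; apply/negP => n12.
have n0 : (0 < n)%N.
  by case: (posnP n) => // n0; move: L12; rewrite /L n0 ln0 //; lra.
have Ln : L < n%:R by apply: ln_sublinear; rewrite ltr0n.
have : n%:R <= 12 :> R by rewrite ler_nat.
by rewrite leNgt (le_lt_trans L12 Ln).
Qed.

Lemma degree_ge12 : 12 <= d.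
Proof.
apply: le_trans dL; apply: le_trans L12 _.
by rewrite exprS ler_peMr ?exprn_ege1 //; move: L12; lra.
Qed.

(** Since d >= 12 > e, only O(log n) expansion steps ever occur. *)
Lemma exponent_le_ln m : d ^+ m <= n%:R -> m%:R <= L.
Proof.
move=> dm; rewrite -ler_expR /L lnK; last first.
  by rewrite posrE ltr0n; apply: leq_trans ln_ge12_nat_gt.
apply: le_trans dm; rewrite -[m%:R]mulr1 expRM_natl.
have d12 := degree_ge12.
apply: lerXn2r; rewrite ?nnegrE ?expR_ge0 //; first by lra.
have h : expR (1 / 2) <= 2 :> R.
  by apply: le_trans (@expR_le_quadratic R (1 / 2) _) _ => //; rewrite expr2; lra.
have -> : (1 : R) = 1 / 2 + 1 / 2 by lra.
rewrite expRD; have := expR_ge0 (1 / 2 : R); nra.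
Qed.

(** The losses multiply to at most exp(12 j / L). The range 2 L leaves room for [rho.+1] steps. *)
Lemma expansion_loss_le j : j%:R <= 2 * L -> (1 + 2 * (6 / L)) ^+ j <= expR 24.
Proof.
move=> jL; have L0 : 0 < L by move: L12; lra.
have e0 : 0 < 6 / L by rewrite divr_gt0.
apply: le_trans (_ : expR (2 * (6 / L)) ^+ j <= _).
  by apply: lerXn2r; rewrite ?nnegrE ?expR_ge0 ?expR_ge1Dx //; lra.
rewrite -expRM_natl ler_expR.
rewrite (_ : j%:R * _ = 12 * j%:R / L); last by field; apply: lt0r_neq0.
by rewrite ler_pdivrMr //; lra.
Qed.

End Logarithmic.

Section MainBounds.
Set Implicit Arguments.
Unset Strict Implicit.
Unset Printing Implicit Defensive.
Variables (R : realType) (n k : nat) (p C : R) (e : rel 'I_n).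
Let L : R := ln n%:R.
Let d := p * (n%:R - 1).
Let M : R := expR 24.
Hypotheses (p01 : 0 <= p <= 1) (L12 : 12 <= L) (dL : L ^+ 3 <= d).
Hypotheses (e_refl : reflexive e) (e_sym : symmetric e).
Hypothesis e_tame : tame_graph p (6 / L) e.
(** The factor 16 (M + 12) serves the placement condition; M and M + 12 come from the ball size and
    from the expansion of large sets. The bound on [k] is squared to avoid square roots. *)
Hypotheses (C_large : 16 * (M + 12) * M <= C) (kn : (k < n)%N).
Hypothesis k_large : C ^+ 2 * (n%:R * L) <= k%:R ^+ 2.

Let n12 : (12 < n)%N. Proof. exact: ln_ge12_nat_gt L12. Qed.
Let n2 : (2 <= n)%N. Proof. exact: leq_trans n12. Qed.
Let n0 : 0 < n%:R :> R. Proof. by rewrite ltr0n; apply: leq_trans n12. Qed.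
Let L0 : 0 < L. Proof. by move: L12; lra. Qed.
Let d12 : 12 <= d. Proof. exact: degree_ge12 L12 dL. Qed.
Let d0 : 0 < d. Proof. by move: d12; lra. Qed.
Let M1 : 1 <= M. Proof. by rewrite -expR0 ler_expR; lra. Qed.
Let C192 : 192 <= C.
Proof. by apply: le_trans C_large; have := M1; nra. Qed.
Let C0 : 0 < C. Proof. by have := C192; lra. Qed.
Let p01' : 0 < p <= 1.
Proof.
case/andP: p01 => p0 p1; rewrite p1 andbT lt_neqAle p0 andbT.
by apply: contraTneq d0 => p_eq0; rewrite /d -p_eq0 mul0r ltxx.
Qed.
Let eps01 : 0 < 6 / L <= 1 / 2.
Proof. by rewrite divr_gt0 //= ler_pdivrMr //; move: L12; lra. Qed.

Lemma many_cops : C * L <= k%:R.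
Proof.
rewrite -(@ler_pXn2r _ 2) // ?nnegrE ?mulr_ge0 ?(ltW C0) ?(ltW L0) //.
apply: le_trans k_large; rewrite exprMn ler_pM2l ?exprn_gt0 // expr2 ler_pM2r //.
by apply/ltW/ln_sublinear.
Qed.

Let k0 : 0 < k%:R :> R.
Proof. by apply: lt_le_trans many_cops; rewrite mulr_gt0. Qed.

(** Dividing the bound on d^(m+1) by d >= L^3 gives k d^m L^2 < C n, and L^2 > M C then pays for the
    loss [M]. *)
Lemma tame_capt_ge (m : nat) : (0 < m)%N -> M * C < L ^+ 2 ->
  d ^+ m.+1 < C * n%:R * L / k%:R -> ((m.+1)%:R%:E <= capt R e k)%E.
Proof.
move=> m0 MC; rewrite ltr_pdivlMr // => dm.
have dm0 : 0 < d ^+ m by rewrite exprn_gt0.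
have hL : d ^+ m * k%:R * L ^+ 2 < C * n%:R.
  rewrite -(ltr_pM2r L0); apply: le_lt_trans dm.
  rewrite (_ : d ^+ m * k%:R * L ^+ 2 * L = d ^+ m * k%:R * L ^+ 3); last by ring.
  rewrite (_ : d ^+ m.+1 * k%:R = d ^+ m * k%:R * d); last by rewrite exprSr; ring.
  by rewrite ler_pM2l // mulr_gt0.
have dk : d ^+ m * k%:R * M < n%:R.
  rewrite -(ltr_pM2r C0) [ltRHS]mulrC; apply: le_lt_trans hL.
  by rewrite -[leLHS]mulrA ler_pM2l ?mulr_gt0 // ltW.
have k1 : 1 <= k%:R :> R by rewrite ler1n -(ltr0n R).
have mL : m%:R <= L.
  apply: (exponent_le_ln L12 dL); apply: le_trans (ltW dk).
  by rewrite -mulrA ler_peMr ?(ltW dm0) // mulr_ege1.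
apply: (tame_le_capt eps01 e_refl e_tame).
have loss : (1 + 2 * (6 / L)) ^+ m <= M.
  by apply: (expansion_loss_le L12); rewrite -/L; move: L0; lra.
rewrite exprMn mulrCA [k%:R * _]mulrC.
apply: le_lt_trans (_ : M * (d ^+ m * k%:R) < _); last by rewrite mulrC.
by rewrite ler_wpM2r // mulr_ge0 ?(ltW dm0).
Qed.

(** The first hypothesis bounds the balls to be occupied by M k / C; the second lets N^(rho+1)[S]
    catch enough cops. Hall's condition is checked directly for sets of size at most [m0] and
    through a subset of size [m0] for larger ones. *)
Lemma tame_capt_le (rho : nat) :
  d ^+ rho <= k%:R / C -> C * n%:R * L / k%:R <= d ^+ rho.+1 ->
  (capt R e k <= (rho.+1)%:R%:E)%E.
Proof.
move=> d_small; rewrite ler_pdivrMr // => d_large.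
have e0 := proj1 (andP eps01); have e1 := proj2 (andP eps01).
have k_n : k%:R <= n%:R :> R by rewrite ler_nat ltnW.
have rhoL : rho%:R <= L.
  apply: (exponent_le_ln L12 dL); apply: le_trans d_small _.
  rewrite ler_pdivrMr //; apply: le_trans k_n _.
  by rewrite ler_peMr ?(ltW n0) //; move: C192; lra.
have loss j : (j <= rho.+1)%N -> (1 + 2 * (6 / L)) ^+ j <= M.
  move=> jr; apply: (expansion_loss_le L12).
  have : j%:R <= rho.+1%:R :> R by rewrite ler_nat.
  by rewrite -natr1 -/L; move: L12; lra.
pose D := d ^+ rho.+1.
have D0 : 0 < D by rewrite exprn_gt0.
have ball v : #|iter rho (nbhd e) [set v]%SET|%:R <= M * (k%:R / C).
  have [deg _] := e_tame; have := card_iter_nbhd_le [set v]%SET rho deg.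
  rewrite cards1 mulr1 -/d exprMn => /le_trans; apply.
  by apply: ler_pM => //; rewrite ?loss ?exprn_ge0 ?ltW //; lra.
have a2 : (1 + 2 * (6 / L)) / d <= 1 / 2.
  by rewrite ler_pdivrMr //; move: d12; lra.
have invN (S : {set 'I_n}) : S != finset.set0 ->
    #|iter rho.+1 (nbhd e) S|%:R^-1 <= M / (D * #|S|%:R) + 12 / n%:R.
  move=> S0.
  apply: le_trans (tame_inv_card_iter_nbhd p01' eps01 n2 e_refl e_tame rho.+1 S0 a2) _.
  rewrite lerD2r expr_div_n invfM [leRHS]mulrA -/d -/D.
  by rewrite !ler_pM2r ?invr_gt0 ?ltr0n ?card_gt0 ?loss.
have Npos (S : {set 'I_n}) : S != finset.set0 -> 0 < #|iter rho.+1 (nbhd e) S|%:R :> R.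
  rewrite -card_gt0 ltr0n => /leq_trans; apply.
  exact/subset_leq_card/(sub_iter_nbhd _ e_refl (leq0n rho.+1)).
(* As D m0 > n, sets of size [m0] expand to a positive proportion of all vertices; as m0 <= n / D +
   1, they are still small enough for the placement. *)
pose m0 := (Num.truncn (n%:R / D)).+1.
have /andP[m0le m0gt] : (m0.-1)%:R <= n%:R / D < m0%:R.
  by apply: truncn_itv; rewrite divr_ge0 // ltW.
have DV : D^-1 <= k%:R / (C * n%:R * L).
  rewrite -div1r ler_pdivrMr // mulrAC ler_pdivlMr ?mulr_gt0 //.
  by rewrite mul1r [leRHS]mulrC.
have n4 : (4 <= #|'I_n|)%N by rewrite card_ord; apply: ltn_trans n12.
have spread (S : {set 'I_n}) : (#|S| <= m0)%N -> S != finset.set0 ->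
    8 * L * #|S|%:R <= k%:R * #|iter rho.+1 (nbhd e) S|%:R / n%:R.
  move=> Sm0 S0; have s0 : 0 < #|S|%:R :> R by rewrite ltr0n card_gt0.
  have N0 := Npos S S0; set N := #|iter _ _ S|%:R in N0 *.
  have sm : #|S|%:R <= n%:R / D + 1.
    by apply: le_trans (_ : m0%:R <= _); [rewrite ler_nat | rewrite /m0 -natr1 lerD2r].
  (* Half of the bound comes from C n L <= k D, the other half from k >= C L. *)
  have h : #|S|%:R * N^-1 <= k%:R / (8 * L * n%:R).
    apply: le_trans (ler_wpM2l (ltW s0) (invN S S0)) _.
    have -> : #|S|%:R * (M / (D * #|S|%:R) + 12 / n%:R) =
        M / D + 12 / n%:R * #|S|%:R by field; rewrite !lt0r_neq0.
    apply: le_trans (_ : M / D + 12 / n%:R * (n%:R / D + 1) <= _).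
      by rewrite lerD2l ler_wpM2l // divr_ge0 // ltW.
    have -> : M / D + 12 / n%:R * (n%:R / D + 1) = (M + 12) * D^-1 + 12 / n%:R.
      by field; rewrite !lt0r_neq0.
    have h1 : (M + 12) * D^-1 <= k%:R / (16 * L * n%:R).
      apply: le_trans (ler_wpM2l _ DV) _; first by move: M1; lra.
      rewrite mulrA ler_pdivrMr ?mulr_gt0 //.
      rewrite [leRHS](_ : _ = k%:R * (C / 16)); last by field; rewrite !lt0r_neq0.
      rewrite mulrC ler_pM2l // ler_pdivlMr //.
      apply: le_trans C_large; rewrite [leLHS]mulrC.
      by apply: ler_peMr M1; move: M1; lra.
    have h2 : 12 / n%:R <= k%:R / (16 * L * n%:R).
      rewrite ler_pdivrMr // mulrAC [leRHS](_ : _ = k%:R / (16 * L)); last by field; rewrite !lt0r_neq0.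
      rewrite ler_pdivlMr ?mulr_gt0 //; apply: le_trans many_cops.
      by rewrite [16 * L]mulrC mulrA mulrAC ler_pM2r //; move: C192; lra.
    apply: le_trans (lerD h1 h2) _.
    rewrite [leLHS](_ : _ = k%:R / (8 * L * n%:R)) //.
    by field; rewrite !lt0r_neq0.
  move: h; rewrite ler_pdivrMr // mulrAC ler_pdivlMr ?mulr_gt0 // => h.
  rewrite ler_pdivlMr //; apply: le_trans h; rewrite le_eqVlt; apply/orP; left; apply/eqP; ring.
have [|f hf] := @exists_spread_placement R 'I_n k (iter rho.+1 (nbhd e))
    (fun S => #|S| <= m0)%N n4; first by rewrite card_ord.
apply: (capt_le_of_hall R e_refl (f := f)) => // [|v A sA]; first by rewrite -(ltr0n R).
have [->|A0] := eqVneq A finset.set0; first by rewrite cards0.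
rewrite -(ler_nat R); have [Am|/ltnW mA] := leqP #|A| m0.
  apply: le_trans (hf A Am A0); rewrite card_ord.
  rewrite invfM [_^-1 * _]mulrC mulrA ler_pdivlMr //.
  apply: le_trans (spread A Am A0); have a0 : 0 <= #|A|%:R :> R by [].
  by have := L12; nra.
(* Already N^(rho+1)[S] holds at least k / (4 (M + 12)) >= M k / C cops, as many as the ball has
   vertices at most. *)
have [S sS cS] := subset_of_card mA.
have S0 : S != finset.set0 by rewrite -card_gt0 cS.
have := hf S; rewrite cS leqnn card_ord => /(_ isT S0) hS.
apply: le_trans (_ : M * (k%:R / C) <= _).
  by apply: le_trans (ball v); rewrite ler_nat subset_leq_card.
apply: le_trans (_ : #|[set i | f i \in iter rho.+1 (nbhd e) S]%SET|%:R <= _); last first.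
  rewrite ler_nat subset_leq_card //; apply/fintype.subsetP => i.
  by rewrite inE => h; rewrite inE; apply: (fintype.subsetP (iter_nbhdS _ _ sS)) h.
apply: le_trans hS.
have : #|iter rho.+1 (nbhd e) S|%:R^-1 <= (M + 12) / n%:R.
  apply: le_trans (invN S S0) _; rewrite [leRHS]mulrDl lerD2r cS.
  rewrite ler_pM2l ?expR_gt0 // lef_pV2 ?posrE ?mulr_gt0 //.
  by rewrite mulrC -ler_pdivrMr // ltW.
have N0 := Npos S S0; set N := #|iter _ _ S|%:R in N0 *.
have Q0 : 0 < M + 12 by move: M1; lra.
rewrite -div1r ler_pdivrMr // mulrAC ler_pdivlMr // mul1r => nQ.
apply: le_trans (_ : k%:R / (4 * (M + 12)) <= _).
  rewrite mulrCA ler_pM2l // ler_pdivrMr // mulrC ler_pdivlMr ?mulr_gt0 //.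
  apply: le_trans C_large; have : 0 <= (M + 12) * M by rewrite mulr_ge0 ?expR_ge0 ?ltW.
  lra.
rewrite -mulrA ler_pM2l // -div1r ler_pdivrMr ?mulr_gt0 // mulrAC ler_pdivlMr ?mulr_gt0 //.
lra.
Qed.

End MainBounds.

(** * The order of the capture time *)

Lemma tame_capt_theta (R : realType) (n k r : nat) (p : R) (e : rel 'I_n) :
  let M := expR 24 in let C := 16 * (M + 12) * M in
  let L := ln n%:R in let d := p * (n%:R - 1) in
  0 <= p <= 1 -> 12 + M * C <= L -> L ^+ 3 <= d -> reflexive e -> symmetric e ->
  tame_graph p (6 / L) e -> (k < n)%N -> C * Num.sqrt (n%:R * L) <= k%:R ->
  is_least_radius C n d k r ->
  ((1 * r%:R)%:E <= capt R e k <= (2 * r%:R)%:E)%E.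
Proof.
move=> M C L d p01 Llarge dL e_refl e_sym e_tame kn kC [r0 good least].
have M0 : 0 < M by apply: expR_gt0.
have C0 : 0 < C by rewrite !mulr_gt0 // addr_gt0.
have MC0 : 0 < M * C by rewrite mulr_gt0.
have L12 : 12 <= L by lra.
have L0 : 0 < L by lra.
have n0 : 0 < n%:R :> R by rewrite ltr0n (leq_trans _ kn).
have k2 : C ^+ 2 * (n%:R * L) <= k%:R ^+ 2.
  rewrite -[n%:R * L]sqr_sqrtr ?mulr_ge0 ?(ltW n0) ?(ltW L0) // -exprMn.
  by apply: lerXn2r => //; rewrite nnegrE ?ler0n //; apply: mulr_ge0 (ltW C0) (sqrtr_ge0 _).
have CC : 16 * (M + 12) * M <= C by [].
have kCL : C * L <= k%:R := many_cops L12 CC k2.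
have C1 : 1 <= C.
  have M1 : 1 <= M by rewrite -expR0 ler_expR.
  by rewrite /C; nra.
have k0 : 0 < k%:R :> R by apply: lt_le_trans kCL; rewrite mulr_gt0.
have k_C : C <= k%:R.
  by apply: le_trans kCL; apply: ler_peMr (ltW C0) _; lra.
(* This is the assumption k >= C sqrt(n log n), rearranged. *)
have CnLk : C * n%:R * L / k%:R <= k%:R / C.
  rewrite ler_pdivrMr // [leRHS]mulrAC ler_pdivlMr // -expr2; apply: le_trans k2.
  by rewrite le_eqVlt; apply/orP; left; apply/eqP; ring.
rewrite mul1r; apply/andP; split.
  (* For r = 1, fewer than n cops leave a free starting vertex; for r >= 2, the exponent r - 1 is
     not good. *)
  case: r r0 good least => [//|[_ _ _|m _ _ least]].
    have eps01 : 0 < 6 / L <= 1 / 2.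
      by rewrite divr_gt0 //= ler_pdivrMr //; lra.
    apply: (tame_le_capt eps01 e_refl e_tame).
    by rewrite expr0 mulr1 ltr_nat.
  apply: (tame_capt_ge L12 dL e_refl e_tame CC k2) => //.
    by rewrite -/L -/M expr2; nra.
  rewrite ltNge; apply/negP => gm; have := least m.+1 isT gm.
  by rewrite ltnn.
(* Here rho = r is allowed, and r + 1 <= 2 r. *)
have [dr|dr] := leP (d ^+ r) (k%:R / C).
  apply: le_trans (tame_capt_le p01 L12 dL e_refl e_sym e_tame CC kn k2 dr good) _.
  by rewrite lee_fin -natrM ler_nat mul2n -addnn -addn1 leq_add2l.
(* If r >= 2, then d^r > k / C >= C n L / k would make r - 1 good. With r = 1, rho = 0 works and one
   round suffices. *)
have r1 : r = 1%N.
  case: r r0 good least dr => [//|[//|m]] _ _ least /ltW/(le_trans CnLk) gm.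
  by have := least m.+1 isT gm; rewrite ltnn.
have d1 : C * n%:R * L / k%:R <= d ^+ 1.
  by apply: le_trans CnLk (ltW _); rewrite -r1.
have d00 : d ^+ 0 <= k%:R / C by rewrite expr0 ler_pdivlMr // mul1r.
apply: le_trans (tame_capt_le p01 L12 dL e_refl e_sym e_tame CC kn k2 d00 d1) _.
by rewrite lee_fin r1 mulr1 ler_nat.
Qed.

Theorem theorem5p1 (R : realType) :
  exists C : R, 0 < C /\
  forall (p : nat -> R) (k r : nat -> nat),
    let d := fun n : nat => p n * (n%:R - 1) in
    (forall n : nat, 0 <= p n <= 1) ->
    (\forall n \near \oo, ln (n%:R : R) ^+ 3 <= d n) ->
    (\forall n \near \oo,
       C * Num.sqrt (n%:R * ln (n%:R : R)) <= (k n)%:R /\ (k n < n)%N) ->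
    (\forall n \near \oo, is_least_radius C n (d n) (k n) (r n)) ->
    exists c1 c2 : R, [/\ 0 < c1, 0 < c2 &
      (fun n : nat => gnp_prob (p n) (fun E : {set {set 'I_n}} =>
         ((c1 * (r n)%:R)%:E <= capt R (radj E) (k n))%E /\
         (capt R (radj E) (k n) <= (c2 * (r n)%:R)%:E)%E))
      @ \oo --> (1 : R)].
Proof.
pose M : R := expR 24; pose C := 16 * (M + 12) * M.
exists C; split; first by rewrite !mulr_gt0 ?addr_gt0 ?expR_gt0.
move=> p k r d p01 d_large k_large r_least; exists 1, 2; split => //.
apply/cvgrPdist_le => /= eps eps0; near=> n.
have n0 : 0 < n%:R :> R by rewrite ltr0n; near: n; exact: nbhs_infty_gt.
(* This gives both L >= 12 and L^2 > M C. *)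
have L_large : 12 + M * C <= ln n%:R.
  rewrite -ler_expR lnK ?posrE //; near: n; exact: nbhs_infty_ger.
have n_eps : 4 / n%:R <= eps.
  rewrite ler_pdivrMr // mulrC -ler_pdivrMr //; near: n; exact: nbhs_infty_ger.
have dn : ln n%:R ^+ 3 <= d n by near: n.
have [kn1 kn2] : C * Num.sqrt (n%:R * ln n%:R) <= (k n)%:R /\ (k n < n)%N by near: n.
have rn : is_least_radius C n (d n) (k n) (r n) by near: n.
have MC0 : 0 < M * C by rewrite !mulr_gt0 ?addr_gt0 ?expR_gt0.
have L12 : 12 <= ln n%:R :> R by lra.
set A := fun E => _; have PA : 1 - 4 / n%:R <= gnp_prob (p n) A.
  apply: (gnp_tame (p01 n) L12 dn) => E tameE.
  apply/andP; exact: (@tame_capt_theta R n (k n) (r n) (p n) (radj E) (p01 n) L_large dn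
    (radj_refl E) (radj_sym E) tameE kn2 kn1 rn).
have PA1 := gnp_prob_le1 (p01 n) A.
rewrite ger0_norm ?subr_ge0 //; lra.
Unshelve. all: by end_near.
Qed.
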